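(* Let $\mathcal{G}=\langle V,E,w\rangle$ be a bidding mean-payoff game and $v\in V$. If Max's initial budget is greater than $1-\textsc{Thresh}(v)$, then Max has a constant-memory strategy from $v$ that guarantees a positive mean-payoff value.
   Context: A bidding game is played on a finite directed graph $(V,E)$ (every vertex having an outgoing edge) by moving a token. The players, Min and Max, hold budgets summing to $1$. In each round both simultaneously submit a bid, a real number between $0$ and their current budget; the higher bidder pays his bid to the other player and moves the token along an outgoing edge; ties are resolved by some fixed tie-breaking rule. A strategy maps each finite history (visited vertices together with winning bids and winners) to a legal bid and a successor to move to upon winning. In a bidding mean-payoff game $\langle V,E,w\rangle$, $w:V\to\mathbb{Z}$; for an infinite play $\pi=v_0v_1\ldots$ the energy of the length-$n$ prefix is $E(\pi^n)=\sum_{i=0}^{n-1}w(v_i)$ and the mean-payoff value is $\liminf_{n\to\infty}E(\pi^n)/n$. The threshold budget $\textsc{Thresh}:V\to[0,1]$ is such that if Min's budget at $v$ exceeds $\textsc{Thresh}(v)$ then Min can guarantee a non-positive mean-payoff value, and if Max's budget exceeds $1-\textsc{Thresh}(v)$ then Max can guarantee a strictly positive mean-payoff value. A memoryless strategy at a vertex is a pair consisting of a successor (moved to upon winning) and a simple bid function (a polynomial or a selection among a constant number of polynomials) of the current budget and current energy; a constant-memory strategy is one whose choices additionally depend on a memory state drawn from a set of size bounded by a constant independent of the play. *)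

(* Defs.v *)
From HB Require Import structures.
From mathcomp Require Import all_boot all_order all_algebra.
From mathcomp Require Import boolp classical_sets reals ereal sequences.

Set Implicit Arguments.
Unset Strict Implicit.
Unset Printing Implicit Defensive.

Import Order.TTheory GRing.Theory Num.Theory.
Local Open Scope ring_scope.

Inductive player := Min | Max.

Record mpgame (V : finType) := MPGame {
  edge : rel V;
  edge_total : forall v, exists u, edge v u;
  weight : V -> int }.

(* One round of a play: the vertex the token was on, the winning bid, and the
   winner of the bidding. *)
Record round (R V : Type) := Round {
  rvertex : V;
  rbid : R;
  rwinner : player }.

(* The completed rounds, oldest first, and the current vertex. *)
Definition history (R V : Type) : Type := (seq (round R V) * V)%type.

Definition extend (R V : Type) (h : history R V) (p : player) (b : R) (u : V) :
    history R V :=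
  (rcons h.1 (Round h.2 b p), u).

(* The winning bid is paid to the other player. *)
Definition pay (R : realType) (V : Type) (B : R) (r : round R V) : R :=
  match rwinner r with Max => B - rbid r | Min => B + rbid r end.

(* Throughout, B0 is Max's initial budget; Min's is 1 - B0. *)
Definition budget (R : realType) (V : Type) (p : player) (B0 : R)
    (h : history R V) : R :=
  match p with
  | Max => foldl (@pay R V) B0 h.1
  | Min => 1 - foldl (@pay R V) B0 h.1
  end.

(* The current vertex is not counted, so that a history with n rounds has the
   energy w(v_0) + ... + w(v_(n-1)). *)
Definition energy (R : Type) (V : finType) (G : mpgame V) (h : history R V) :
    int :=
  \sum_(r <- h.1) weight G (rvertex r).

Inductive legal_history (R : realType) (V : finType) (G : mpgame V) (B0 : R)
    (v0 : V) : history R V -> Prop :=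
| legal_start : legal_history G B0 v0 ([::], v0)
| legal_extend h p b u :
    legal_history G B0 v0 h ->
    0 <= b <= budget p B0 h ->
    edge G h.2 u ->
    legal_history G B0 v0 (extend h p b u).

(* A bid, and the vertex to move to if the bidding is won. *)
Definition strategy (R V : Type) : Type := history R V -> R * V.

Definition legal_strategy (R : realType) (V : finType) (G : mpgame V)
    (p : player) (B0 : R) (v0 : V) (s : strategy R V) : Prop :=
  forall h, legal_history G B0 v0 h ->
    0 <= (s h).1 <= budget p B0 h /\ edge G h.2 (s h).2.

(* A tie-breaking rule designates the winner of a tie at a given history. *)
Definition tie_rule (R V : Type) : Type := history R V -> player.

Definition bid_winner (R : realType) (V : Type) (tie : tie_rule R V)
    (h : history R V) (bmin bmax : R) : player :=
  if bmin < bmax then Max else if bmax < bmin then Min else tie h.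

Definition play_step (R : realType) (V : Type) (tie : tie_rule R V)
    (smin smax : strategy R V) (h : history R V) : history R V :=
  match bid_winner tie h (smin h).1 (smax h).1 with
  | Max => extend h Max (smax h).1 (smax h).2
  | Min => extend h Min (smin h).1 (smin h).2
  end.

Definition play_prefix (R : realType) (V : Type) (tie : tie_rule R V)
    (v0 : V) (smin smax : strategy R V) (n : nat) : history R V :=
  iter n (play_step tie smin smax) ([::], v0).

Definition mean_payoff (R : realType) (V : finType) (G : mpgame V)
    (tie : tie_rule R V) (v0 : V) (smin smax : strategy R V) : \bar R :=
  limn_einf (fun n =>
    ((energy G (play_prefix tie v0 smin smax n))%:~R / n%:R)%:E).

Definition min_guarantees_nonpos (R : realType) (V : finType) (G : mpgame V)
    (tie : tie_rule R V) (B0 : R) (v0 : V) (smin : strategy R V) : Prop :=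
  legal_strategy G Min B0 v0 smin /\
  forall smax, legal_strategy G Max B0 v0 smax ->
    (mean_payoff G tie v0 smin smax <= 0)%E.

Definition max_guarantees_pos (R : realType) (V : finType) (G : mpgame V)
    (tie : tie_rule R V) (B0 : R) (v0 : V) (smax : strategy R V) : Prop :=
  legal_strategy G Max B0 v0 smax /\
  forall smin, legal_strategy G Min B0 v0 smin ->
    (0 < mean_payoff G tie v0 smin smax)%E.

(* In the first clause b is Min's budget, in the second one Max's. *)
Definition is_threshold (R : realType) (V : finType) (G : mpgame V)
    (tie : tie_rule R V) (Thresh : V -> R) : Prop :=
  forall v,
    [/\ 0 <= Thresh v <= 1,
        forall b, Thresh v < b -> b <= 1 ->
          exists smin, min_guarantees_nonpos G tie (1 - b) v smin
      & forall b, 1 - Thresh v < b -> b <= 1 ->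
          exists smax, max_guarantees_pos G tie b v smax].

(* A selection among finitely many polynomials in the budget and the energy;
   {poly {poly R}} is evaluated with the outer variable at the energy k and the
   inner one at the budget B. *)
Definition simple_bid (R : realType) (f : R -> int -> R) : Prop :=
  exists ps : seq {poly {poly R}},
    forall B k, exists2 q, q \in ps & f B k = q.[(k%:~R)%:P].[B].

(* The memory is a finite automaton reading the completed rounds. *)
Record cmem_strategy (R : realType) (V : finType) := CMemStrategy {
  memory : finType;
  mem_init : memory;
  mem_update : memory -> round R V -> memory;
  cm_succ : memory -> V -> V;
  cm_bid : memory -> V -> R -> int -> R;
  cm_bid_simple : forall m v, simple_bid (cm_bid m v) }.

Definition cmem_to_strategy (R : realType) (V : finType) (G : mpgame V)
    (p : player) (B0 : R) (c : cmem_strategy R V) : strategy R V :=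
  fun h =>
    let m := foldl (@mem_update R V c) (mem_init c) h.1 in
    (cm_bid m h.2 (budget p B0 h) (energy G h), cm_succ m h.2).

(* Main.v *)
(** Write [avg x v] for the mean of the largest and the smallest value of [x] on
    the successors of [v].  The iteration [x := max 0 (w + avg x)], started at 0,
    splits the vertices: where it stays bounded its supremum [z] satisfies
    [w + avg z <= z]; this set is closed under edges.  On the vertices that cannot
    reach it the iterates tend to infinity, which gives [p] and [mu > 0] with
    [p + mu <= w + avg p].

    A player with such a potential bids a fraction [c * (max p - min p) / 2] of
    the budget; winning costs what the potential gains, so that
    [ln budget + c * (energy + p - n * mu)] decreases by at most O(c^2) in each
    round, while [ln budget <= 0].  For Max a small constant [c] gives a positive
    mean payoff from any positive budget; for Min, [c] proportional to [1 / n] at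
    round [n] gives a nonpositive one, since the harmonic series diverges.

    It remains to reach one of the two sets.  The budget needed to reach a set in
    [k] rounds obeys an [avg]-recursion in [k]; in the limit the budgets that the
    two players need add up to at most 1, by uniqueness of the harmonic extension.
    Hence, if Max wins from some budget [B' < B], then [B] suffices to reach the
    good set in some fixed number of rounds, which a finite memory can count. *)

Require Import Defs.
From mathcomp Require Import all_boot all_order all_algebra.
From mathcomp Require Import boolp classical_sets reals ereal sequences.
From mathcomp Require Import exp ring lra.

Set Implicit Arguments.
Unset Strict Implicit.
Unset Printing Implicit Defensive.

Import Order.TTheory GRing.Theory Num.Theory.
Local Open Scope ring_scope.

(** * Extremal successors and the averaging operator *)

Section Neighbours.
Context {R : realType} {V : finType} (G : mpgame V).
Implicit Types (x y : V -> R) (u v : V).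

Definition some_succ v : V := xchoose (edge_total G v).
Definition up x v : V := [arg max_(u > some_succ v | edge G v u) x u]%O.
Definition dn x v : V := [arg min_(u < some_succ v | edge G v u) x u]%O.
Definition avg x v : R := (x (up x v) + x (dn x v)) / 2.
Definition strength x v : R := (x (up x v) - x (dn x v)) / 2.

Lemma some_succ_edge v : edge G v (some_succ v).
Proof. exact: xchooseP (edge_total G v). Qed.

Lemma up_edge x v : edge G v (up x v).
Proof. by rewrite /up; case: arg_maxP => //; exact: some_succ_edge. Qed.

Lemma dn_edge x v : edge G v (dn x v).
Proof. by rewrite /dn; case: arg_minP => //; exact: some_succ_edge. Qed.

Lemma le_up x v u : edge G v u -> x u <= x (up x v).
Proof.
by rewrite /up; case: arg_maxP => [|i _ h /h //]; exact: some_succ_edge.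
Qed.

Lemma dn_le x v u : edge G v u -> x (dn x v) <= x u.
Proof.
by rewrite /dn; case: arg_minP => [|i _ h /h //]; exact: some_succ_edge.
Qed.

Lemma strength_ge0 x v : 0 <= strength x v.
Proof. by have := le_up x (dn_edge x v); rewrite /strength; lra. Qed.

Lemma avg_le x y e v : (forall u, edge G v u -> x u <= y u + e) ->
  avg x v <= avg y v + e.
Proof.
move=> xy; rewrite /avg.
have := xy _ (up_edge x v); have := le_up y (up_edge x v).
have := xy _ (dn_edge y v); have := dn_le x (dn_edge y v).
lra.
Qed.

Lemma avgN x v : avg (fun u => - x u) v = - avg x v.
Proof.
rewrite /avg; set x' := fun u => - x u.
have := le_up x (dn_edge x' v); have := dn_le x (up_edge x' v).
have : - x (dn x v) <= - x (up x' v) := le_up x' (dn_edge x v).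
have : - x (dn x' v) <= - x (up x v) := dn_le x' (up_edge x v).
rewrite {3 4}/x'; lra.
Qed.

Definition edge_closed (D : pred V) := forall v u, D v -> edge G v u -> D u.

End Neighbours.

Lemma eventually_fin (V : finType) (P : V -> nat -> Prop) :
  (forall u, exists N, forall n, (N <= n)%N -> P u n) ->
  exists N, forall n, (N <= n)%N -> forall u, P u n.
Proof.
move=> /choice[N hN]; exists (\max_u N u)%N => n hn u.
by apply: hN; apply: leq_trans hn; exact: leq_bigmax.
Qed.

(** * Energy levels and the potentials obtained from them *)

Section EnergyLevels.
Context {R : realType} {V : finType} (G : mpgame V).

Fixpoint level n v : R :=
  if n is n'.+1 then Num.max 0 ((weight G v)%:~R + avg G (level n') v) else 0.

Lemma level_ge0 n v : 0 <= level n v.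
Proof. by case: n => //= n; rewrite le_max lexx. Qed.

Lemma level_ub n v : (weight G v)%:~R + avg G (level n) v <= level n.+1 v.
Proof. by rewrite /= le_max lexx orbT. Qed.

Lemma level_leS n v : level n v <= level n.+1 v.
Proof.
elim: n v => [|n IH] v; first exact: level_ge0.
rewrite [level n.+1 v]/= ge_max level_ge0 /=.
apply: le_trans (level_ub n.+1 v); rewrite lerD2l -[leRHS]addr0.
by apply: avg_le => u _; rewrite addr0.
Qed.

Lemma level_homo v : {homo level^~ v : m n / (m <= n)%N >-> m <= n}.
Proof. by apply: homo_leq => [//|m n p|n]; [exact: le_trans|exact: level_leS]. Qed.

Definition bounded_level v : bool := `[< exists M, forall n, level n v <= M >].

(** Levels are nonnegative, so the largest level among the successors is at most twice their [avg],
    which a bound at [v] controls. *)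
Lemma bounded_level_closed : edge_closed G bounded_level.
Proof.
move=> v u /asboolP[M hM] vu; apply/asboolP.
exists (2 * (M - (weight G v)%:~R)) => n.
have := hM n.+1; have := level_ub n v; have := le_up (level n) vu.
have := level_ge0 n (dn G (level n) v); rewrite /avg; lra.
Qed.

(** As the graph is finite, the levels of all bounded vertices eventually come within [e] of their
    suprema, so the recursion passes to the limit. *)
Lemma bounded_level_potential : exists z : V -> R,
  forall v, bounded_level v -> (weight G v)%:~R + avg G z v <= z v.
Proof.
pose E v := [set x | exists n, x = level n v]%classic.
have supE v : bounded_level v -> has_sup (E v).
  move=> /asboolP[M hM]; split; first by exists (level 0 v), 0%N.
  by exists M => _ [n ->].
exists (fun v => sup (E v)) => v bv; apply/ler_addgt0Pr => e e0.
have [N hN] : exists N, forall n, (N <= n)%N ->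
    forall u, bounded_level u -> sup (E u) <= level n u + e.
  apply: eventually_fin => u; case: (boolP (bounded_level u)) => [bu|_]; last first.
    by exists 0%N.
  have [_ [N ->] hN] := sup_adherent e0 (supE u bu).
  by exists N => n Nn _; have := level_homo u Nn; lra.
have : avg G (fun v => sup (E v)) v <= avg G (level N) v + e.
  by apply: avg_le => u vu; apply: hN => //; exact: bounded_level_closed vu.
have : level N.+1 v <= sup (E v).
  by apply: ub_le_sup; [case: (supE v bv)|exists N.+1].
by have := level_ub N v; lra.
Qed.

(** Unboundedness at [v] alone need not persist along edges; quantifying over all reachable vertices
    gives a set that the token cannot leave. *)
Definition safe v : bool := [forall u, connect (edge G) v u ==> ~~ bounded_level u].

Lemma safe_closed : edge_closed G safe.
Proof.
move=> v u /forallP sv vu; apply/forallP => w; apply/implyP => uw.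
by have /implyP := sv w; apply; apply: connect_trans uw; exact: connect1.
Qed.

Lemma safe_unbounded v M : safe v -> exists n, M < level n v.
Proof.
move=> /forallP/(_ v); rewrite connect0 /= => /negP nb; apply: contrapT => hM.
apply: nb; apply/asboolP; exists M => n; rewrite leNgt; apply/negP => Mn.
by apply: hM; exists n.
Qed.

(* On the safe vertices the levels eventually obey the untruncated recursion
   [y_(i+1) = w + avg y_i], which is monotone and commutes with the addition of
   constants; so if it gains 1 in j steps, then [max_(i < j) (y_i - i / j)] gains
   [1 / j] in every step. *)
Lemma safe_potential : exists (p : V -> R) (mu : R), 0 < mu /\
  forall v, safe v -> p v + mu <= (weight G v)%:~R + avg G p v.
Proof.
have above (M : V -> R) : exists N, forall n, (N <= n)%N ->
    forall u, safe u -> M u < level n u.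
  apply: eventually_fin => u; case: (boolP (safe u)) => [su|_]; last by exists 0%N.
  have [N hN] := safe_unbounded (M u) su.
  by exists N => n Nn _; exact: lt_le_trans hN (level_homo u Nn).
have [N0 hN0] := above (fun=> 0).
have [N1 hN1] := above (fun u => level N0 u + 1).
pose y i := level (N0 + i).
have yS i u : safe u -> y i.+1 u = (weight G u)%:~R + avg G (y i) u.
  move=> su; have : 0 < y i.+1 u by apply: hN0 => //; exact: leq_addr.
  rewrite /y addnS /=; by case: (leP 0) => // ?; rewrite ltxx.
have y1 u : safe u -> y 0%N u + 1 <= y N1.+1 u.
  move=> su; apply: ltW; rewrite /y addn0; apply: hN1 => //.
  by rewrite addnS ltnW // ltnS leq_addl.
pose mu : R := N1.+1%:R^-1.
have mu0 : 0 < mu by rewrite invr_gt0.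
have mu1 : N1.+1%:R * mu = 1 by rewrite divff.
pose f u (i : 'I_N1.+1) := y i u - i%:R * mu.
pose p u := f u [arg max_(i > ord0) f u i]%O.
have fp u i : f u i <= p u by rewrite /p; case: arg_maxP => // j _; apply.
exists p, mu; split=> // v sv.
have step i : (i < N1.+1)%N -> y i.+1 v - i%:R * mu <= (weight G v)%:~R + avg G p v.
  move=> iN; rewrite yS //.
  suff : avg G (y i) v <= avg G p v + i%:R * mu by lra.
  by apply: avg_le => u _; have := fp u (Ordinal iN); rewrite /f /=; lra.
rewrite {1}/p; case: arg_maxP => // -[[|i] iN] _ _; rewrite /f /=.
  have := step N1 (ltnSn _); have := y1 v sv.
  by move: mu1; rewrite -natr1; lra.
by have := step i (ltnW iN); rewrite -natr1; lra.
Qed.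

End EnergyLevels.

(** * Budgets that suffice to reach a set *)

Section Reachability.
Context {R : realType} {V : finType} (G : mpgame V).
Implicit Types D : pred V.

(** Any budget above this value suffices to enter [D] within [k] rounds; off [D] with no round left
    it is 1, which no budget exceeds. *)
Fixpoint reach_thr D k v : R :=
  if D v then 0 else if k is k'.+1 then avg G (reach_thr D k') v else 1.

Lemma reach_thr_in D k v : D v -> reach_thr D k v = 0.
Proof. by case: k => [|k] /= ->. Qed.

Lemma reach_thrS D k v : ~~ D v -> reach_thr D k.+1 v = avg G (reach_thr D k) v.
Proof. by move=> /negbTE /= ->. Qed.

Lemma reach_thr_itv D k v : 0 <= reach_thr D k v <= 1.
Proof.
elim: k v => [|k IH] v /=; case: (D v); rewrite ?lexx ?ler01 //.
have /andP[] := IH (up G (reach_thr D k) v).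
have /andP[] := IH (dn G (reach_thr D k) v).
by rewrite /avg; lra.
Qed.

Lemma reach_thr_leS D k v : reach_thr D k.+1 v <= reach_thr D k v.
Proof.
elim: k v => [|k IH] v.
  rewrite [reach_thr D 0 v]/=; case: ifP => [Dv|_]; first by rewrite reach_thr_in.
  by case/andP: (reach_thr_itv D 1 v).
case: (boolP (D v)) => [Dv|Dv]; first by rewrite !reach_thr_in.
rewrite !(reach_thrS _ Dv) -[leRHS]addr0.
by apply: avg_le => u _; rewrite addr0.
Qed.

Lemma reach_thr_homo D v : {homo (reach_thr D)^~ v : m n / (m <= n)%N >-> n <= m}.
Proof.
apply: (@homo_leq _ _ (fun x y => y <= x)) => [//|m n p mn np|n].
  exact: le_trans np mn.
exact: reach_thr_leS.
Qed.

Definition reach_lim D v : R := inf [set x | exists k, x = reach_thr D k v]%classic.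

Lemma has_inf_reach_thr D v : has_inf [set x | exists k, x = reach_thr D k v]%classic.
Proof.
split; first by exists (reach_thr D 0 v), 0%N.
by exists 0 => _ [k ->]; have /andP[] := reach_thr_itv D k v.
Qed.

Lemma reach_lim_le D k v : reach_lim D v <= reach_thr D k v.
Proof. by apply: ge_inf; [case: (has_inf_reach_thr D v)|exists k]. Qed.

Lemma reach_lim_lt D v b : reach_lim D v < b -> exists k, reach_thr D k v < b.
Proof.
move=> vb; have [] := @inf_adherent _ _ (b - reach_lim D v) _ (has_inf_reach_thr D v).
  by rewrite subr_gt0.
by move=> _ [k ->]; rewrite addrC subrK => h; exists k.
Qed.

Lemma reach_lim_in D v : D v -> reach_lim D v <= 0.
Proof. by move=> Dv; have := reach_lim_le D 0 v; rewrite reach_thr_in. Qed.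

Lemma reach_lim_le1 D v : reach_lim D v <= 1.
Proof. by apply: le_trans (reach_lim_le D 0 v) _; case/andP: (reach_thr_itv D 0 v). Qed.

Lemma reach_lim_avg D v : ~~ D v -> reach_lim D v <= avg G (reach_lim D) v.
Proof.
move=> Dv; apply/ler_addgt0Pr => e e0.
have [N hN] : exists N, forall n, (N <= n)%N ->
    forall u, reach_thr D n u <= reach_lim D u + e.
  apply: eventually_fin => u.
  have [|N hN] := @reach_lim_lt D u (reach_lim D u + e); first by rewrite ltrDl.
  by exists N => n Nn; apply: le_trans (ltW hN); exact: reach_thr_homo.
apply: le_trans (reach_lim_le D N.+1 v) _; rewrite reach_thrS //.
by apply: avg_le => u _; exact: hN.
Qed.

(* Where the sum is maximal, and among these vertices [T] is, both functions
   are constant on the successors; so the maximum propagates along a path into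
   [A]. *)
Lemma subharmonic_sum_le1 (A C : pred V) (S T : V -> R) v :
  (forall u, A u || C u -> S u + T u <= 1) ->
  (forall u, ~~ A u -> S u <= avg G S u) ->
  (forall u, ~~ C u -> T u <= avg G T u) ->
  (forall u, ~~ C u -> exists2 a, A a & connect (edge G) u a) ->
  S v + T v <= 1.
Proof.
move=> AC1 subS subT CA.
have [m mP] : exists m, forall u, S u + T u <= S m + T m.
  exists [arg max_(u > v) (S u + T u)]%O => u.
  by case: arg_maxP => // i _; exact.
apply: le_trans (mP v) _; rewrite leNgt; apply/negP => m1.
pose Z u := S u + T u == S m + T m.
have [q Zq qP] : exists2 q, Z q & forall u, Z u -> T u <= T q.
  exists [arg max_(u > m | Z u) T u]%O; case: arg_maxP => //; by rewrite /Z eqxx.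
have notAC u : Z u -> ~~ (A u || C u).
  by move=> /eqP Zu; apply/negP => /AC1; rewrite Zu leNgt m1.
pose W u := Z u && (T u == T q).
have Wstep u w : W u -> edge G u w -> W w.
  move=> /andP[Zu /eqP Tu] uw; have := notAC _ Zu; rewrite negb_or => /andP[Au Cu].
  have upT := up_edge G T u; have upS := up_edge G S u.
  have [Sw1 Sw2] := (le_up S uw, dn_le S uw).
  have [Tw1 Tw2] := (le_up T uw, dn_le T uw).
  move/eqP: (Zu) (subS _ Au) (subT _ Cu) (mP (up G T u)) (dn_le S upT).
  move: (mP (up G S u)) (dn_le T upS); rewrite /avg => h1 h2 h3 h4 h5 h6 h7.
  have ZupT : Z (up G T u).
    by apply/eqP; clear -h1 h2 h3 h4 h5 h6 h7; lra.
  have h8 := qP _ ZupT.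
  have Tw : T w = T q by clear -h5 h8 Tu Tw1 Tw2; lra.
  rewrite /W Tw eqxx andbT; apply/eqP.
  by clear -h1 h2 h3 h4 h5 h8 Tu Tw Sw1 Sw2; lra.
have Cq : ~~ C q by have := notAC q Zq; rewrite negb_or => /andP[].
have [a Aa qa] := CA q Cq.
suff /andP[/notAC] : W a by rewrite Aa.
have : W q by rewrite /W Zq eqxx.
case/connectP: qa => s qs -> {Aa}.
elim: s (q) qs => [|w s IH] u //= /andP[uw ws] Wu.
by apply: IH => //; exact: Wstep uw.
Qed.

(** [A] will be the target of one player and [C] that of the other. On either set one limit is at
    most 0 and the other at most 1. *)
Lemma reach_lim_compl (A C : pred V) v :
  (forall u, ~~ C u -> exists2 a, A a & connect (edge G) u a) ->
  reach_lim A v + reach_lim C v <= 1.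
Proof.
apply: subharmonic_sum_le1 => [u|u|u]; try exact: reach_lim_avg.
move=> /orP[/reach_lim_in|/reach_lim_in].
  by have := reach_lim_le1 C u; lra.
by have := reach_lim_le1 A u; lra.
Qed.

End Reachability.

(** * Estimates for the logarithm of the budget *)

Section LogGrowth.
Context {R : realType}.

(** The bound [ln (1 + x) <= x], taken at the reciprocal of [1 + y], gives
    [y / (1 + y) <= ln (1 + y)]; the error [y ^+ 2 / (1 + y)] is at most [2 * y ^+ 2] because
    [1 + y] is at least 1/2. *)
Lemma ln1D_ge (y : R) : - 2^-1 <= y <= 2^-1 -> y - 2 * y ^+ 2 <= ln (1 + y).
Proof.
move=> /andP[y1 y2]; have y0 : 0 < 1 + y by lra.
have : ln (1 + ((1 + y)^-1 - 1)) <= (1 + y)^-1 - 1.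
  by apply: le_ln1Dx; rewrite ltrBrDl subrr invr_gt0.
rewrite addrC subrK lnV ?posrE // => h.
have : (1 + y)^-1 - 1 <= - (y - 2 * y ^+ 2).
  rewrite lerBlDr -div1r ler_pdivrMr //; nra.
lra.
Qed.

Lemma ln_growth (b b' y : R) : 0 < b -> - 2^-1 <= y <= 2^-1 ->
  b * (1 + y) <= b' -> ln b + (y - 2 * y ^+ 2) <= ln b'.
Proof.
move=> b0 hy bb'; have y0 : 0 < 1 + y by case/andP: hy; lra.
have by0 : 0 < b * (1 + y) by exact: mulr_gt0.
apply: (@le_trans _ _ (ln (b * (1 + y)))).
  by rewrite lnM ?posrE // lerD2l ln1D_ge.
by rewrite ler_ln ?posrE // (lt_le_trans by0).
Qed.

Lemma mul_half_itv (y b : R) : 0 <= y <= 2^-1 -> 0 <= b -> 0 <= y * b <= b / 2.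
Proof.
move=> /andP[y0 y1] b0; rewrite mulr_ge0 //= mulrC.
exact: ler_wpM2l.
Qed.

End LogGrowth.

(** * Plays from the point of view of one player *)

Definition opponent (p : player) : player :=
  match p with Min => Max | Max => Min end.

Definition sgn_player (R : realType) (p : player) : R :=
  match p with Max => 1 | Min => -1 end.

Section Plays.
Context {R : realType} {V : finType} (G : mpgame V).
Implicit Types (h : history R V) (s : strategy R V) (p q : player).

Lemma budget_win p (B0 : R) h b u :
  budget p B0 (extend h p b u) = budget p B0 h - b.
Proof. by case: p; rewrite /budget /= foldl_rcons /pay //= opprD addrA. Qed.

Lemma budget_lose p (B0 : R) h b u :
  budget p B0 (extend h (opponent p) b u) = budget p B0 h + b.
Proof. by case: p; rewrite /budget /= foldl_rcons /pay //= opprB addrA addrAC. Qed.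

Lemma energy_extend h p b u :
  energy G (extend h p b u) = energy G h + weight G h.2.
Proof. by rewrite /energy /= -cats1 big_cat big_seq1. Qed.

Lemma size_extend h p b u : size (extend h p b u).1 = (size h.1).+1.
Proof. by rewrite size_rcons. Qed.

Lemma budget_itv (B0 : R) v0 p h : 0 <= B0 <= 1 -> legal_history G B0 v0 h ->
  0 <= budget p B0 h <= 1.
Proof.
move=> hB0 lh; suff : 0 <= budget Max B0 h <= 1 by case: p => /=; lra.
elim: lh => {h} [//|h q b u _ IH hb _].
by case: q hb => hb; rewrite (budget_win, budget_lose Max); move: IH hb => /=; lra.
Qed.

(* One round seen by a player who only knows that the opponent cannot win with a
   lower bid; the tie-breaking rule is thereby left open. *)
Definition follows p s h h' : Prop :=
  h' = extend h p (s h).1 (s h).2 \/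
  exists b u, [/\ (s h).1 <= b, edge G h.2 u & h' = extend h (opponent p) b u].

Definition run p s (B0 : R) v0 (h_ : nat -> history R V) : Prop :=
  h_ 0%N = ([::], v0) /\
  forall n, legal_history G B0 v0 (h_ n) /\ follows p s (h_ n) (h_ n.+1).

Lemma play_prefix_run (tie : tie_rule R V) (B0 : R) v0 smin smax :
  legal_strategy G Min B0 v0 smin -> legal_strategy G Max B0 v0 smax ->
  run Min smin B0 v0 (play_prefix tie v0 smin smax) /\
  run Max smax B0 v0 (play_prefix tie v0 smin smax).
Proof.
move=> lmin lmax; set h_ := play_prefix tie v0 smin smax.
have lh n : legal_history G B0 v0 (h_ n).
  elim: n => [|n IH]; first exact: legal_start.
  rewrite /h_ /play_prefix iterS -/(play_prefix tie v0 smin smax n) -/(h_ n).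
  have [bmin emin] := lmin _ IH; have [bmax emax] := lmax _ IH.
  by rewrite /play_step; case: bid_winner; exact: legal_extend.
suff fh n : follows Min smin (h_ n) (h_ n.+1) /\ follows Max smax (h_ n) (h_ n.+1).
  by split; split=> // n; split=> //; case: (fh n).
have [_ emin] := lmin _ (lh n); have [_ emax] := lmax _ (lh n).
rewrite /h_ /play_prefix iterS -/(play_prefix tie v0 smin smax n) -/(h_ n).
rewrite /play_step /bid_winner.
case: (ltgtP (smin (h_ n)).1 (smax (h_ n)).1) => [lt|lt|eq].
- split; [right|by left].
  by exists (smax (h_ n)).1, (smax (h_ n)).2; split=> //; exact: ltW.
- split; [by left|right].
  by exists (smin (h_ n)).1, (smin (h_ n)).2; split=> //; exact: ltW.
- case: (tie _); split; try (by left); right.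
  + by exists (smin (h_ n)).1, (smin (h_ n)).2; split=> //; rewrite eq.
  + by exists (smax (h_ n)).1, (smax (h_ n)).2; split=> //; rewrite eq.
Qed.

End Plays.

(** * The two-phase strategy: reach [D], then follow the potential *)

Section Drive.
Context {R : realType} {V : finType} (G : mpgame V).
Variables (p : player) (B0 : R) (v0 : V) (D : pred V) (k : nat).
Variables (P : V -> R) (mu S : R) (c : nat -> R).

(* The bid [0] only occurs off the plays consistent with the strategy. *)
Definition drive_strategy : strategy R V := fun h =>
  if D h.2 then (c (size h.1) * strength G P h.2 * budget p B0 h, up G P h.2)
  else let x := reach_thr G D (k - size h.1).-1 in
    (if strength G x h.2 <= budget p B0 h then strength G x h.2 else 0,
     dn G x h.2).

(** The sign lets both players be treated as maximizers. *)
Definition drive_potential (h : history R V) : R :=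
  sgn_player R p * (energy G h)%:~R + P h.2.

Hypotheses (hB0 : 0 <= B0 <= 1) (closedD : edge_closed G D).
Hypothesis subP :
  forall v, D v -> P v + mu <= sgn_player R p * (weight G v)%:~R + avg G P v.
Hypotheses (hS : forall v, strength G P v <= S) (c_ge0 : forall n, 0 <= c n).
Hypothesis cS : forall n, c n * S <= 2^-1.

Lemma drive_frac n v : 0 <= c n * strength G P v <= 2^-1.
Proof.
rewrite mulr_ge0 ?strength_ge0 //=; apply: le_trans (cS n).
exact: ler_wpM2l.
Qed.

Lemma drive_legal : legal_strategy G p B0 v0 drive_strategy.
Proof.
move=> h lh; have := budget_itv p hB0 lh; rewrite /drive_strategy.
case: ifP => [Dh|_] hb /=; split; [|exact: up_edge| |exact: dn_edge].
  case/andP: hb => b0 _; have := mul_half_itv (drive_frac (size h.1) h.2) b0.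
  by lra.
by case: ifP => hs; [rewrite hs strength_ge0|case/andP: hb => ->; rewrite lexx].
Qed.

Variable h_ : nat -> history R V.
Hypothesis hrun : run G p drive_strategy B0 v0 h_.

Lemma drive_size n : size (h_ n).1 = n.
Proof.
case: hrun => h0 hs; elim: n => [|n IH]; first by rewrite h0.
by case: (hs n) => _ [->|[b [u [_ _ ->]]]]; rewrite size_extend IH.
Qed.

Lemma drive_round n :
  let s := drive_strategy (h_ n) in
  [/\ edge G (h_ n).2 s.2, budget p B0 (h_ n.+1) = budget p B0 (h_ n) - s.1,
      (h_ n.+1).2 = s.2 &
      energy G (h_ n.+1) = energy G (h_ n) + weight G (h_ n).2] \/
  [/\ edge G (h_ n).2 (h_ n.+1).2,
      budget p B0 (h_ n) + s.1 <= budget p B0 (h_ n.+1) &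
      energy G (h_ n.+1) = energy G (h_ n) + weight G (h_ n).2].
Proof.
case: hrun => _ /(_ n)[lh [->|[b [u [sb e ->]]]]] /=; [left|right]; split => //.
- by case: (drive_legal lh).
- exact: budget_win.
- exact: energy_extend.
- by rewrite budget_lose lerD2l.
- exact: energy_extend.
Qed.

(** A win leads to the cheapest successor, whose threshold is below the mean by exactly the bid; a
    loss brings in at least the bid, enough even for the costliest successor. Inside [D] the
    threshold is 0 and at most half of the budget is spent. *)
Lemma drive_reach n : reach_thr G D k v0 < budget p B0 ([::], v0) -> (n <= k)%N ->
  reach_thr G D (k - n) (h_ n).2 < budget p B0 (h_ n).
Proof.
move=> hk; elim: n => [|n IH] nk; first by case: hrun => -> _; rewrite subn0.
have {IH} := IH (ltnW nk); have := drive_round n.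
rewrite /drive_strategy drive_size; case: ifP => [Dh|/negbT Dh].
  rewrite (reach_thr_in _ _ Dh) /=.
  move=> hr b0; have := mul_half_itv (drive_frac n (h_ n).2) (ltW b0).
  case: hr => [[e -> e2 _]|[e hb _]].
    by rewrite e2 reach_thr_in ?(closedD Dh e) //; lra.
  by rewrite reach_thr_in ?(closedD Dh e) //; lra.
have kn : (k - n = (k - n.+1).+1)%N by rewrite subnS prednK // subn_gt0.
rewrite kn reach_thrS //=; set x := reach_thr G D (k - n.+1).
have x0 u : 0 <= x u by have /andP[] := reach_thr_itv (R := R) G D (k - n.+1) u.
(* Thresholds are nonnegative, so the strength is at most their [avg] and is affordable: the default
   bid 0 does not occur. *)
move=> hr hb; have sb : strength G x (h_ n).2 <= budget p B0 (h_ n).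
  by have := x0 (dn G x (h_ n).2); move: hb; rewrite /avg /strength; lra.
move: hr; rewrite sb.
case=> [[e -> -> _]|[e hb' _]]; first by move: hb; rewrite /avg /strength; lra.
by have := le_up x e; move: hb hb'; rewrite /avg /strength; lra.
Qed.

Hypothesis hk : reach_thr G D k v0 < budget p B0 ([::], v0).

Lemma drive_stay n : (k <= n)%N -> D (h_ n).2 /\ 0 < budget p B0 (h_ n).
Proof.
move=> /subnKC <-; elim: (n - k)%N => [|m [Dm bm]].
  (* After [k] rounds the threshold off [D] is 1, which no legal budget exceeds; hence the token is
     in [D]. *)
  have := drive_reach hk (leqnn k); rewrite addn0 subnn /=; case: ifP => // _.
  case: hrun => _ /(_ k)[lh _]; have := budget_itv p hB0 lh; lra.
rewrite addnS; have := drive_round (k + m); rewrite /drive_strategy Dm /=.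
have := mul_half_itv (drive_frac (size (h_ (k + m)%N).1) (h_ (k + m)%N).2) (ltW bm).
move=> hy [[e -> e2 _]|[e hb _]].
  by rewrite e2; split; [exact: closedD e|lra].
by split; [exact: closedD e|lra].
Qed.

Lemma drive_budget_le0 n : ln (budget p B0 (h_ n)) <= 0.
Proof.
by case: hrun => _ /(_ n)[lh _]; apply: ln_le0; case/andP: (budget_itv p hB0 lh).
Qed.

(** Let [y] be the fraction bid. A win multiplies the budget by [1 - y] and raises the potential by
    at least [mu] plus the strength; a loss multiplies it by at least [1 + y] and changes the
    potential by at least [mu] minus the strength. Taking logarithms costs only a quadratic
    error. *)
Lemma drive_drift n : (k <= n)%N ->
  ln (budget p B0 (h_ n)) -
    c n * (drive_potential (h_ n.+1) - drive_potential (h_ n) - mu) -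
    2 * (c n * S) ^+ 2 <= ln (budget p B0 (h_ n.+1)).
Proof.
move=> kn; have [Dn bn] := drive_stay kn.
have := drive_round n; rewrite /drive_strategy Dn drive_size /drive_potential /=.
have := subP Dn; have := drive_frac n (h_ n).2; have := cS n; have := c_ge0 n.
have := ler_wpM2l (c_ge0 n) (hS (h_ n).2).
set y := c n * strength G P _; set z := c n * S => yz c0 zS /andP[y0 y1] hP.
have y2 : 2 * y ^+ 2 <= 2 * z ^+ 2 by rewrite ler_pM2l // lerXn2r ?nnegrE //; lra.
have Ny2 : (- y) ^+ 2 = y ^+ 2 by rewrite sqrrN.
case=> [[e b' v' ->]|[e b' ->]]; rewrite rmorphD mulrDr.
  have hl : ln (budget p B0 (h_ n)) + (- y - 2 * (- y) ^+ 2) <=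
      ln (budget p B0 (h_ n.+1)).
    by apply: ln_growth => //; [lra|rewrite b'; lra].
  have : y <= c n * (sgn_player R p * (weight G (h_ n).2)%:~R +
                     P (h_ n.+1).2 - P (h_ n).2 - mu).
    by apply: ler_wpM2l => //; rewrite v'; move: hP; rewrite /avg /strength; lra.
  by move: hl; rewrite Ny2; lra.
have hl : ln (budget p B0 (h_ n)) + (y - 2 * y ^+ 2) <= ln (budget p B0 (h_ n.+1)).
  by apply: ln_growth => //; [lra|lra].
have : c n * - strength G P (h_ n).2 <=
    c n * (sgn_player R p * (weight G (h_ n).2)%:~R +
           P (h_ n.+1).2 - P (h_ n).2 - mu).
  apply: ler_wpM2l => //; have := dn_le P e.
  by move: hP; rewrite /avg /strength; lra.
by rewrite mulrN -/y; lra.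
Qed.

End Drive.

(** * Uniform bounds, lower limits and harmonic divergence *)

Lemma fin_bounded (R : realType) (V : finType) (x : V -> R) :
  exists M, 0 <= M /\ forall v, `|x v| <= M.
Proof.
exists (\sum_v `|x v|); split=> [|v]; first exact: sumr_ge0.
by rewrite (bigD1 v) //= lerDl sumr_ge0.
Qed.

Lemma strength_bounded (R : realType) (V : finType) (G : mpgame V) (x : V -> R) :
  exists S, 0 < S /\ forall v, strength G x v <= S.
Proof.
have [M [M0 hM]] := fin_bounded x; exists (1 + M); split=> [|v]; first by lra.
have := hM (up G x v); have := hM (dn G x v); rewrite !ler_norml /strength; lra.
Qed.

Section Liminf.
Context {R : realType}.
Implicit Type u : (\bar R)^nat.

Lemma limn_einf_sup_inf u : limn_einf u = ereal_sup (range (einfs u)).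
Proof. by rewrite limn_einf_lim; apply/cvg_lim => //; exact: cvg_einfs_sup. Qed.

Lemma limn_einf_ge u (e : \bar R) N :
  (forall n, (N <= n)%N -> (e <= u n)%E) -> (e <= limn_einf u)%E.
Proof.
move=> eu; rewrite limn_einf_sup_inf.
apply: le_trans (ereal_sup_ubound _); last by exists N.
by apply: le_ereal_inf_tmp => _ [n /= Nn <-]; exact: eu.
Qed.

Lemma limn_einf_gt0 (x : nat -> R) : (0 < limn_einf (EFin \o x))%E ->
  exists e N, 0 < e /\ forall n, (N <= n)%N -> e <= x n.
Proof.
rewrite limn_einf_sup_inf => /ereal_sup_gt[_ [N _ <-] hN].
have le n : (N <= n)%N -> (einfs (EFin \o x) N <= (x n)%:E)%E.
  by move=> Nn; apply: ereal_inf_lbound; exists n.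
case: (einfs _ _) hN le => [e e0 le||//]; first by exists e, N; split.
by move=> _ /(_ N (leqnn N)); rewrite leye_eq.
Qed.

(** Since [ln n.+3 - ln n.+2 <= 1 / n.+2], the sequence grows at least as fast as [d * ln n.+2]. *)
Lemma increasing_harmonic_unbounded (L : nat -> R) (d K : R) N : 0 < d ->
  (forall n, (N <= n)%N -> L n + d / n.+2%:R <= L n.+1) ->
  ~ (forall n, (N <= n)%N -> L n <= K).
Proof.
move=> d0 hL hK.
have lnL m : L N + d * (ln (N + m).+2%:R - ln N.+2%:R) <= L (N + m)%N.
  elim: m => [|m IH]; first by rewrite addn0 subrr mulr0 addr0.
  rewrite addnS; apply: le_trans (hL _ (leq_addr _ _)).
  have -> : ln (N + m).+3%:R = ln (N + m).+2%:R + ln (1 + (N + m).+2%:R^-1) :> R.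
    rewrite -lnM ?posrE ?ltr0n // ?addr_gt0 ?invr_gt0 ?ltr0n //.
    by rewrite mulrDr mulr1 divff ?pnatr_eq0 // natr1.
  have : ln (1 + (N + m).+2%:R^-1) <= (N + m).+2%:R^-1 :> R.
    by apply: le_ln1Dx; apply: lt_trans (_ : 0 < _); rewrite ?invr_gt0 ?ltr0n ?oppr_lt0.
  move=> /(ler_wpM2l (ltW d0)); move: IH.
  by move: (ln _) (ln (1 + _)) (ln _) (d / _) => x y z t; lra.
pose X := (K - L N) / d + ln N.+2%:R.
pose m := Num.bound (expR X).
have : X < ln (N + m).+2%:R.
  rewrite -ltr_expR lnK ?posrE ?ltr0n //.
  apply: lt_le_trans (_ : m%:R <= _); last by rewrite ler_nat !leqW ?leq_addl.
  by apply: archi_boundP; exact: expR_ge0.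
rewrite /X -ltrBrDr ltr_pdivrMr // => h.
by have := lnL m; have := hK (N + m)%N (leq_addr _ _); move: h; rewrite mulrC; lra.
Qed.

End Liminf.

(** * Mean payoff enforced by the strategy for each player *)

Section DriveOutcome.
Context {R : realType} {V : finType} (G : mpgame V).
Variables (B0 : R) (v0 : V) (D : pred V) (k : nat) (P : V -> R) (S : R).
Hypotheses (hB0 : 0 <= B0 <= 1) (closedD : edge_closed G D).
Hypotheses (hS : forall v, strength G P v <= S).

Lemma drive_max_pos (mu c : R) h_ : 0 < mu -> 0 < c -> c * S <= 2^-1 ->
  4 * c * S ^+ 2 <= mu ->
  (forall v, D v -> P v + mu <= (weight G v)%:~R + avg G P v) ->
  reach_thr G D k v0 < B0 ->
  run G Max (drive_strategy G Max B0 D k P (fun=> c)) B0 v0 h_ ->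
  exists (e : R) N, 0 < e /\
    forall n, (N <= n)%N -> e <= (energy G (h_ n))%:~R / n%:R.
Proof.
move=> mu0 c0 cS cS2 subP hk hr.
have subP1 v : D v ->
    P v + mu <= sgn_player R Max * (weight G v)%:~R + avg G P v.
  by rewrite mul1r; exact: subP.
have drift := drive_drift hB0 closedD subP1 hS (fun=> ltW c0) (fun=> cS) hr hk.
have ln0 := drive_budget_le0 hB0 hr.
have [M [M0 hM]] := fin_bounded P.
pose Phi n := drive_potential G Max P (h_ n).
pose g n := ln (budget Max B0 (h_ n)) + c * Phi n.
(* The quadratic error takes away at most half of the drift [c * mu] of a round. *)
have cmu : 2 * (c * S) ^+ 2 <= c * mu / 2.
  by have := ler_wpM2l (ltW c0) cS2; rewrite exprMn expr2; lra.
have hg m : g k + m%:R * (c * mu / 2) <= g (k + m)%N.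
  elim: m => [|m IH]; first by rewrite addn0 mul0r addr0.
  have := drift _ (leq_addr m k); rewrite addnS -[m.+1%:R]natr1 -!/(Phi _); cbv beta.
  move: IH cmu; rewrite /g; lra.
pose K := M + k%:R * mu / 2 - g k / c.
have hE n : (k <= n)%N -> n%:R * mu / 2 - K <= (energy G (h_ n))%:~R.
  move=> kn; have := hg (n - k)%N; rewrite subnKC // natrB // /g.
  have := ln0 n; have := hM (h_ n).2; rewrite ler_norml => /andP[_ hP].
  move=> l0 hgn.
  have : (g k / c + (n%:R - k%:R) * mu / 2) * c <= Phi n * c.
    by rewrite mulrDl divfK ?gt_eqF // /g; lra.
  rewrite ler_pM2r // /Phi /drive_potential mul1r /K; lra.
have K0 : 0 <= 4 * `|K| / mu by rewrite divr_ge0 ?mulr_ge0 // ltW.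
(* The energy grows at rate [mu / 2] up to the constant [K], and from this round on [K] costs at
   most [mu / 4] per round. *)
exists (mu / 4), (maxn k.+1 (Num.bound (4 * `|K| / mu))); split; first by lra.
move=> n; rewrite geq_max => /andP[kn bn].
rewrite ler_pdivlMr ?ltr0n ?(leq_trans _ kn) //.
have := hE n (ltnW kn).
have : 4 * `|K| / mu <= n%:R.
  by apply: le_trans (ltW (archi_boundP K0)) _; rewrite ler_nat.
rewrite ler_pdivrMr //; have := ler_norm K; lra.
Qed.

(** If the energy stayed above [e * n], lowering the coefficient from [c n] to [c n.+1] would add
    about [c0 * e / n.+2] to [L] in each round, against an error of order [1 / n ^ 2]. So [L] would
    diverge, although it is bounded above. *)
Lemma drive_min_nonpos (c0 : R) h_ : 0 < c0 -> c0 * S <= 2^-1 -> 0 <= S ->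
  (forall v, D v -> P v <= - (weight G v)%:~R + avg G P v) ->
  reach_thr G D k v0 < 1 - B0 ->
  run G Min (drive_strategy G Min B0 D k P (fun n => c0 / n.+1%:R)) B0 v0 h_ ->
  ~ exists (e : R) N, 0 < e /\
    forall n, (N <= n)%N -> e <= (energy G (h_ n))%:~R / n%:R.
Proof.
move=> c00 cS S0 subP hk hr [e [N [e0 hE]]].
pose c n : R := c0 / n.+1%:R.
have subP1 v : D v ->
    P v + 0 <= sgn_player R Min * (weight G v)%:~R + avg G P v.
  by rewrite addr0 mulN1r; exact: subP.
have c_ge0 n : 0 <= c n by rewrite divr_ge0 // ltW.
have c_le n : c n <= c0 by rewrite ler_pdivrMr ?ltr0n // ler_peMr ?(ltW c00) // ler1n.
have cSn n : c n * S <= 2^-1 by apply: le_trans cS; exact: ler_wpM2r.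
have drift := drive_drift hB0 closedD subP1 hS c_ge0 cSn hr hk.
have ln0 := drive_budget_le0 hB0 hr.
have [M [M0 hM]] := fin_bounded P.
pose Y n := - drive_potential G Min P (h_ n).
have hY n : (N < n)%N -> e * n%:R - M <= Y n.
  move=> Nn; have := hE n (ltnW Nn).
  rewrite ler_pdivlMr ?ltr0n ?(leq_trans _ Nn) // /Y /drive_potential mulN1r.
  by have := hM (h_ n).2; rewrite ler_norml; lra.
pose L n := ln (budget Min B0 (h_ n)) - c n * Y n.
(* [K] collects the bound on [P] and the quadratic error, using [n.+2 / n.+1 <= 2]; beyond [N'] it
   is at most half of [e * n.+1]. *)
pose K := M + 4 * c0 * S ^+ 2.
have K0 : 0 <= 2 * K / e.
  rewrite divr_ge0 ?(ltW e0) // mulr_ge0 // addr_ge0 //.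
  by rewrite !mulr_ge0 ?exprn_ge0 // ltW.
pose N' := maxn (maxn k N.+1) (Num.bound (2 * K / e)).
apply: (@increasing_harmonic_unbounded _ L (c0 * e / 2) (c0 * M) N') => [|n|n].
- by rewrite divr_gt0 ?mulr_gt0.
- rewrite !geq_max => /andP[/andP[kn Nn] bn].
  have := drift n kn; rewrite subr0 => hd.
  pose a : R := n.+1%:R; pose b : R := n.+2%:R.
  have a0 : 0 < a by rewrite ltr0n.
  have b0 : 0 < b by rewrite ltr0n.
  have ab : b = a + 1 by rewrite /a /b natr1.
  have a1 : 1 <= a by rewrite ler1n.
  have Ka : 2 * K <= a * e.
    rewrite -ler_pdivrMr //; apply: le_trans (ltW (archi_boundP K0)) _.
    by rewrite ler_nat; apply: leq_trans bn _.
  have := hY n.+1 (leqW Nn); rewrite -/a => hYn.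
  have cc : c n - c n.+1 = c0 / (a * b).
    by rewrite /c -/a -/b ab; field; rewrite -?ab; lra.
  have cY : (c n - c n.+1) * (e * a - M) <= (c n - c n.+1) * Y n.+1.
    by apply: ler_wpM2l => //; rewrite cc divr_ge0 ?mulr_ge0 // ltW.
  have c2 : 2 * (c n * S) ^+ 2 <= c0 / (a * b) * (4 * c0 * S ^+ 2).
    have -> : 2 * (c n * S) ^+ 2 = c0 / (a * b) * (2 * c0 * S ^+ 2 * (b / a)).
      by rewrite /c -/a; field; lra.
    apply: ler_wpM2l; first by rewrite divr_ge0 ?mulr_ge0 // ltW.
    have -> : 4 * c0 * S ^+ 2 = 2 * c0 * S ^+ 2 * 2 by ring.
    apply: ler_wpM2l; first by rewrite !mulr_ge0 ?exprn_ge0 // ltW.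
    by rewrite ler_pdivrMr //; lra.
  have main : c0 * e / 2 / b <= c0 / (a * b) * (e * a - K).
    have -> : c0 * e / 2 / b = c0 / (a * b) * (e * a / 2) by field; lra.
    apply: ler_wpM2l; first by rewrite divr_ge0 ?mulr_ge0 // ltW.
    by lra.
  move: cY hd c2 main; rewrite cc -/(c n) -/b /L /K.
  rewrite -[drive_potential G Min P (h_ n.+1)]opprK.
  rewrite -[drive_potential G Min P (h_ n)]opprK -/(Y n) -/(Y n.+1).
  have -> : c n.+1 = c n - c0 / (a * b) by rewrite -cc; ring.
  move: (c0 / (a * b)) (c0 * e / 2 / b) (2 * (c n * S) ^+ 2) (c n) (Y n) (Y n.+1).
  by move=> t r q cn y y'; lra.
- rewrite !geq_max => /andP[/andP[kn Nn] _].
  have Yn : - M <= Y n by apply: le_trans (hY n Nn); rewrite lerDr mulr_ge0 ?(ltW e0).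
  have : c n * - M <= c n * Y n by exact: ler_wpM2l.
  have : c n * M <= c0 * M by exact: ler_wpM2r.
  by have := ln0 n; rewrite /L; lra.
Qed.

End DriveOutcome.

(** * Finite-memory implementation *)

Section Automaton.
Context {R : realType} {V : finType} (G : mpgame V).
Variables (D : pred V) (k : nat) (P : V -> R) (c : R).

Definition drive_bid (m : 'I_k.+1) v (B : R) (e : int) : R :=
  if D v then c * strength G P v * B
  else let b := strength G (reach_thr G D m.-1) v in if b <= B then b else 0.

Lemma drive_bid_simple m v : simple_bid (drive_bid m v).
Proof.
exists [:: ((c * strength G P v)%:P * 'X)%:P;
  (strength G (reach_thr G D m.-1) v)%:P%:P; 0].
move=> B e; rewrite /drive_bid; case: (D v) => /=.
  exists ((c * strength G P v)%:P * 'X)%:P; first by rewrite inE eqxx.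
  by rewrite hornerC hornerM hornerC hornerX.
case: ifP => _; first by
  exists (strength G (reach_thr G D m.-1) v)%:P%:P;
    rewrite ?inE ?eqxx ?orbT // !hornerC.
by exists 0; rewrite ?inE ?eqxx ?orbT // !horner0.
Qed.

(* The memory counts down the rounds left to reach [D]. *)
Definition drive_automaton : cmem_strategy R V :=
  @CMemStrategy R V 'I_k.+1 ord_max (fun m _ => inord m.-1)
    (fun m v => if D v then up G P v else dn G (reach_thr (R := R) G D m.-1) v)
    drive_bid drive_bid_simple.

Lemma drive_automatonE p B0 :
  cmem_to_strategy G p B0 drive_automaton =
  drive_strategy G p B0 D k P (fun=> c).
Proof.
apply/funext => -[rs v]; rewrite /cmem_to_strategy /drive_strategy /= /drive_bid.
have -> : nat_of_ord (foldl (fun (m : 'I_k.+1) _ => inord m.-1) ord_max rs) =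
          (k - size rs)%N.
  elim/last_ind: rs => [|rs r IH]; first by rewrite subn0.
  rewrite foldl_rcons size_rcons inordK IH ?subnS //.
  by apply: leq_ltn_trans (leq_pred _) _; rewrite ltnS leq_subr.
by case: (D v).
Qed.

End Automaton.

(** * Playing the two potentials against the threshold hypothesis *)

Theorem theorem34 (R : realType) (V : finType) (G : mpgame V)
    (tie : tie_rule R V) (Thresh : V -> R) (hT : is_threshold G tie Thresh)
    (v : V) (B : R) (hB : 1 - Thresh v < B) (hB1 : B <= 1) :
  exists c : cmem_strategy R V,
    max_guarantees_pos G tie B v (cmem_to_strategy G Max B c).
Proof.
have [T01 _ maxwins] := hT v.
have [k hk] : exists k, reach_thr G (@safe R V G) k v < B.
  (* Otherwise Min, holding [1 - B'] for some [B'] strictly between [1 - Thresh v] and [B], could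
     reach the bounded vertices and defeat the strategy by which Max wins from [B']. *)
  apply: reach_lim_lt; rewrite ltNge; apply/negP => Bsafe.
  pose B' := (1 - Thresh v + B) / 2.
  have [||smax [lmax pmax]] := maxwins B'; try by rewrite /B'; lra.
  have : reach_lim G (@bounded_level R V G) v < 1 - B'.
    have h :
        reach_lim G (@bounded_level R V G) v + reach_lim G (@safe R V G) v <= 1 :> R.
      apply: reach_lim_compl => u.
      rewrite negb_forall => /existsP[a]; rewrite negb_imply negbK => /andP[ua Aa].
      by exists a.
    by rewrite /B'; lra.
  move=> /reach_lim_lt[k hk].
  have [z hz] := @bounded_level_potential R V G.
  have [S [S0 hS]] := strength_bounded G (fun u => - z u).
  have B'01 : 0 <= B' <= 1 by rewrite /B'; lra.
  pose c0 := (2 * S)^-1.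
  have c00 : 0 < c0 by rewrite invr_gt0; lra.
  have cS : c0 * S <= 2^-1 by rewrite /c0 invfM -mulrA mulVf ?mulr1 // gt_eqF.
  have subP u : @bounded_level R V G u ->
      - z u <= - (weight G u)%:~R + avg G (fun u => - z u) u.
    by move=> /hz; rewrite avgN; lra.
  have clD := @bounded_level_closed R V G.
  set smin := drive_strategy G Min B' (@bounded_level R V G) k (fun u => - z u)
    (fun n => c0 / n.+1%:R).
  have lmin : legal_strategy G Min B' v smin.
    apply: (drive_legal Min (@bounded_level R V G) k B'01 hS) => n.
      by rewrite divr_ge0 // ltW.
    apply: le_trans cS; apply: ler_wpM2r; first exact: ltW.
    by rewrite ler_pdivrMr ?ltr0n // ler_peMr ?(ltW c00) // ler1n.
  have [rmin _] := play_prefix_run tie lmin lmax.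
  apply: (drive_min_nonpos B'01 clD hS c00 cS (ltW S0) subP hk rmin).
  exact: limn_einf_gt0 (pmax _ lmin).
have [p [mu [mu0 hp]]] := @safe_potential R V G.
have [S [S0 hS]] := strength_bounded G p.
have B01 : 0 <= B <= 1 by lra.
(* This value lies below both [1 / (2 * S)] and [mu / (4 * S ^+ 2)], the two bounds that
   [drive_max_pos] requires. *)
pose c := mu / (2 * S * (mu + 2 * S)).
have muS : 0 < mu + 2 * S by lra.
have den0 : 0 < 2 * S * (mu + 2 * S) by rewrite mulr_gt0 //; lra.
have c0 : 0 < c by rewrite divr_gt0.
have cS : c * S <= 2^-1.
  by rewrite /c mulrAC ler_pdivrMr //; nra.
have cS2 : 4 * c * S ^+ 2 <= mu.
  have -> : 4 * c * S ^+ 2 = mu * (4 * S ^+ 2) / (2 * S * (mu + 2 * S)).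
    by rewrite /c; ring.
  by rewrite ler_pdivrMr //; nra.
exists (drive_automaton G (@safe R V G) k p c); rewrite drive_automatonE.
have lmax :
    legal_strategy G Max B v (drive_strategy G Max B (@safe R V G) k p (fun=> c)).
  exact: (drive_legal Max (@safe R V G) k B01 hS (fun=> ltW c0) (fun=> cS)).
split=> // smin lmin.
have [_ rmax] := play_prefix_run tie lmin lmax.
have [e [N [e0 he]]] :=
  drive_max_pos B01 (@safe_closed R V G) hS mu0 c0 cS cS2 hp hk rmax.
apply: (@lt_le_trans _ _ e%:E); first by rewrite lte_fin.
by apply: (@limn_einf_ge _ _ _ N) => n Nn; rewrite lee_fin he.
Qed.
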